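(* Let $n$ be a positive integer and $\mathbf b=(b_1,\dots,b_n)\in\mathbb Z_{>0}^n$, not with $n=1=b_1$. Let $\mathcal B=\mathcal B_{\mathsf{PF}_n}$ if $b_1=1$, and let $\mathcal B=\mathcal B_{\mathsf{St}_n}$ if $b_1\ge2$. Then the map $$\bigtriangleup_{\mathcal B}\longrightarrow\{\text{nonempty faces of }\mathfrak X_n(\mathbf b)\},\qquad N\longmapsto\mathcal F_N:=\bigcap_{B\in N}F_B$$ is an isomorphism between the dual of the face lattice of the nested set complex $\bigtriangleup_{\mathcal B}$ and the face lattice of $\mathfrak X_n(\mathbf b)$; that is, it is a well-defined bijection from the nested sets of $\mathcal B$ (including $\emptyset$) to the nonempty faces of $\mathfrak X_n(\mathbf b)$, with $N_1\subseteq N_2$ if and only if $\mathcal F_{N_1}\supseteq\mathcal F_{N_2}$.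
   Context: A $\mathbf b$-parking function is a list $(\beta_1,\dots,\beta_n)$ of positive integers whose nondecreasing rearrangement $\beta'_1\le\cdots\le\beta'_n$ satisfies $\beta'_i\le b_1+\cdots+b_i$ for all $i$. The polytope $\mathfrak X_n(\mathbf b)\subset\mathbb R^n$ is the convex hull of all $\mathbf b$-parking functions. Write $S_i=\sum_{j=1}^i b_j$ and $[m]=\{1,\dots,m\}$. A building set on a finite set $E$ is a collection $\mathcal B$ of nonempty subsets of $E$ such that (B1) if $I,J\in\mathcal B$ and $I\cap J\ne\emptyset$ then $I\cup J\in\mathcal B$, and (B2) $\{i\}\in\mathcal B$ for all $i\in E$. $\mathcal B_{\max}$ is the collection of inclusion-maximal members of $\mathcal B$. A nested set of $\mathcal B$ is a subset $N\subseteq\mathcal B\setminus\mathcal B_{\max}$ such that (N1) for $I,J\in N$, either $I\subseteq J$, $I\supseteq J$, or $I\cap J=\emptyset$; and (N2) if $J_1,\dots,J_k\in N$ with $k\ge2$ are pairwise disjoint, then $J_1\cup\cdots\cup J_k\notin\mathcal B$. The nested set complex $\bigtriangleup_{\mathcal B}$ is the simplicial complex of all nested sets of $\mathcal B$ (including the empty set). The two building sets on $[n+1]$ are $\mathcal B_{\mathsf{St}_n}=\{\{1\},\dots,\{n\}\}\cup\{T\cup\{n+1\}:T\subseteq[n]\}$ and $\mathcal B_{\mathsf{PF}_n}=\{\{1\},\dots,\{n\}\}\cup\{T\cup\{n+1\}:T\subseteq[n],\ |T|\ne1\}$; under the stated hypotheses, in both cases the unique maximal element is $[n+1]$. For $1\le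 i\le n$ let $L_i=\{x\in\mathfrak X_n(\mathbf b):x_i=1\}$, and for nonempty $I\subseteq[n]$ (with $|I|\ne n-1$ if $b_1=1$) let $U_I=\{x\in\mathfrak X_n(\mathbf b):\sum_{i\in I}x_i=\sum_{i=n-|I|+1}^nS_i\}$; these are the facets of $\mathfrak X_n(\mathbf b)$. For $B\in\mathcal B\setminus\{[n+1]\}$, the facet $F_B$ is defined by $F_{\{i\}}=L_i$ for $1\le i\le n$, and $F_{T\cup\{n+1\}}=U_{[n]\setminus T}$ for $T\subsetneq[n]$ (with $|T|\ne1$ if $b_1=1$). The empty intersection $\mathcal F_\emptyset$ is $\mathfrak X_n(\mathbf b)$ itself. *)

(* Defs.v *)
From mathcomp Require Import all_boot all_order all_algebra.

Set Implicit Arguments.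
Unset Strict Implicit.
Unset Printing Implicit Defensive.

Import Order.TTheory GRing.Theory Num.Theory.

Section NestedSets.
Variable E : finType.
Implicit Types B N : {set {set E}}.
Local Open Scope set_scope.

Definition building_set B : Prop :=
  [/\ set0 \notin B,
      forall I J, I \in B -> J \in B -> I :&: J != set0 -> I :|: J \in B
    & forall i, [set i] \in B].

Definition maximal_members B : {set {set E}} :=
  [set I | maxset (fun J => J \in B) I].

(* Members of a building set are nonempty, so pairwise disjoint J_1, ..., J_k
   are distinct; in (N2) they are thus given by the set M = {J_1, ..., J_k}. *)
Definition nested_set B N : bool :=
  [&& N \subset B :\: maximal_members B,
      [forall I in N, forall J in N,
         [|| I \subset J, J \subset I | [disjoint I & J]]]
    & [forall M : {set {set E}},
         [&& M \subset N, 1 < #|M| & trivIset M]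
         ==> (cover M \notin B)]].

Definition nested_complex B : {set {set {set E}}} := [set N | nested_set B N].

End NestedSets.

(* The ground set [n+1] is 'I_n.+1, with n+1 represented by ord_max and
   [n] = 'I_n embedded by emb. *)
Section BuildingSets.
Variable n : nat.
Local Open Scope set_scope.

Definition emb (i : 'I_n) : 'I_n.+1 := widen_ord (leqnSn n) i.

Definition star_elt (T : {set 'I_n}) : {set 'I_n.+1} :=
  ord_max |: [set emb i | i in T].

Definition B_St : {set {set 'I_n.+1}} :=
  [set [set emb i] | i : 'I_n] :|: [set star_elt T | T : {set 'I_n}].

Definition B_PF : {set {set 'I_n.+1}} :=
  [set [set emb i] | i : 'I_n]
  :|: [set star_elt T | T : {set 'I_n} & #|T| != 1].

Lemma emb_inj : injective emb.
Proof. by move=> i j /(congr1 val) /= ij; apply: val_inj. Qed.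

Lemma emb_neq_max i : (emb i == ord_max) = false.
Proof. by apply/eqP => /(congr1 val) /= e; have := ltn_ord i; rewrite e ltnn. Qed.

Lemma max_star T : ord_max \in star_elt T.
Proof. exact: setU11. Qed.

Lemma emb_star T i : (emb i \in star_elt T) = (i \in T).
Proof. by rewrite in_setU1 emb_neq_max mem_imset //; apply: emb_inj. Qed.

Lemma star_eltU T T' : star_elt T :|: star_elt T' = star_elt (T :|: T').
Proof. by rewrite /star_elt imsetU setUACA setUid. Qed.

Lemma star_elt1 i (T : {set 'I_n}) : i \in T -> [set emb i] :|: star_elt T = star_elt T.
Proof. by move=> iT; apply/setUidPr; rewrite sub1set emb_star. Qed.

Definition singles_or_stars (P : pred {set 'I_n}) : {set {set 'I_n.+1}} :=
  [set [set emb i] | i : 'I_n] :|: [set star_elt T | T : {set 'I_n} & P T].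

Lemma single_in P i : [set emb i] \in singles_or_stars P.
Proof. by rewrite inE [X in X || _]imset_f. Qed.

Lemma star_in (P : pred {set 'I_n}) T : P T -> star_elt T \in singles_or_stars P.
Proof.
by move=> PT; rewrite inE; apply/orP; right; apply: imset_f; rewrite inE.
Qed.

Lemma in_singles_or_stars (P : pred {set 'I_n}) B : B \in singles_or_stars P ->
  (exists i, B = [set emb i]) \/ (exists2 T, P T & B = star_elt T).
Proof.
case/setUP => /imsetP[x xP ->]; [by left; exists x | right; exists x => //].
by move: xP; rewrite inE.
Qed.

Lemma building_set_singles_or_stars (P : pred {set 'I_n}) :
    (forall T T', P T -> P T' -> P (T :|: T')) -> P set0 ->
  building_set (singles_or_stars P).
Proof.
move=> PU P0; split.
- apply/negP => /in_singles_or_stars[[i /setP/(_ (emb i))]|[T _ /setP]].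
    by rewrite !inE eqxx.
  by move=> /(_ ord_max); rewrite max_star inE.
- move=> I J /in_singles_or_stars[[i ->]|[T PT ->]]
     /in_singles_or_stars[[j ->]|[T' PT' ->]] /set0Pn[z].
  + case/setIP => /set1P -> /set1P/emb_inj <-.
    by rewrite setUid single_in.
  + case/setIP => /set1P ->; rewrite emb_star => iT.
    by rewrite star_elt1 // star_in.
  + case/setIP => zT /set1P zj; rewrite zj emb_star in zT.
    by rewrite setUC star_elt1 // star_in.
  + by move=> _; rewrite star_eltU star_in // PU.
- move=> j; have [jn|nj] := ltnP j n.
    have -> : j = emb (Ordinal jn) by apply: val_inj.
    exact: single_in.
  have -> : j = ord_max.
    by apply: val_inj; apply/eqP; rewrite eqn_leq nj -ltnS ltn_ord.
  have -> : [set ord_max] = star_elt set0 by rewrite /star_elt imset0 setU0.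
  exact: star_in.
Qed.

Lemma star_setT : star_elt setT = setT.
Proof.
apply/setP => j; rewrite [RHS]inE; have [jn|nj] := ltnP j n.
  have -> : j = emb (Ordinal jn) by apply: val_inj.
  by rewrite emb_star inE.
have -> : j = ord_max; last exact: max_star.
by apply: val_inj; apply/eqP; rewrite eqn_leq nj -ltnS ltn_ord.
Qed.

Lemma maximal_singles_or_stars (P : pred {set 'I_n}) : P setT ->
  maximal_members (singles_or_stars P) = [set setT].
Proof.
move=> PT; have TB : setT \in singles_or_stars P by rewrite -star_setT star_in.
apply/setP => I; rewrite !inE; apply/maxsetP/eqP => [[_ /(_ setT TB)]|->].
  by move=> <- //; apply: subsetT.
by split=> // J _; rewrite subTset => /eqP.
Qed.

Lemma B_StE : B_St = singles_or_stars xpredT.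
Proof.
congr (_ :|: _); apply/setP => B.
by apply/imsetP/imsetP => -[T _ ->]; exists T; rewrite ?inE.
Qed.

Lemma building_set_St : building_set B_St.
Proof. by rewrite B_StE; apply: building_set_singles_or_stars. Qed.

Lemma building_set_PF : building_set B_PF.
Proof.
apply: building_set_singles_or_stars => [T T'|]; last by rewrite cards0.
move=> T1 T'1; apply/cards1P => -[x TT'].
have sub1 (A : {set 'I_n}) : #|A| != 1 -> A \subset [set x] -> A = set0.
  by move=> A1; rewrite subset1 => /orP[]/eqP // e; rewrite e cards1 in A1.
have T0 : T = set0 by rewrite (sub1 T) // -TT' subsetUl.
have T'0 : T' = set0 by rewrite (sub1 T') // -TT' subsetUr.
by move/setP/(_ x): TT'; rewrite T0 T'0 !inE eqxx.
Qed.

Lemma maximal_St : maximal_members B_St = [set setT].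
Proof. by rewrite B_StE maximal_singles_or_stars. Qed.

Lemma maximal_PF : n != 1 -> maximal_members B_PF = [set setT].
Proof. by move=> n1; rewrite maximal_singles_or_stars // cardsT card_ord. Qed.

End BuildingSets.

From mathcomp Require Import all_classical all_reals.
From mathcomp Require Import convex.

Section Polytope.
Variables (R : realType) (n : nat) (b : 'I_n -> nat).
Local Open Scope classical_set_scope.
Local Open Scope ring_scope.

(* S_i, for 0 <= i <= n; indices of b are shifted down by one. *)
Definition psum (i : nat) : nat := (\sum_(j < n | (j < i)%N) b j)%N.

Definition parking_function (beta : n.-tuple nat) : Prop :=
  (forall i, 0 < tnth beta i)%N /\
  (forall i : 'I_n, nth 0%N (sort leq beta) i <= psum i.+1)%N.

Definition conv_hull (A : set 'rV[R]_n) : set 'rV[R]_n :=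
  smallest (@convex_set R 'rV[R]_n) A.

Definition X_pf : set 'rV[R]_n :=
  conv_hull [set \row_i (tnth beta i)%:R | beta in parking_function].

Definition is_face (P F : set 'rV[R]_n) : Prop :=
  exists (c : 'rV[R]_n) (d : R),
    (forall x, P x -> \sum_i c 0 i * x 0 i <= d) /\
    F = [set x | P x /\ \sum_i c 0 i * x 0 i = d].

Definition L_facet (i : 'I_n) : set 'rV[R]_n := [set x | X_pf x /\ x 0 i = 1].

Definition U_facet (I : {set 'I_n}) : set 'rV[R]_n :=
  [set x | X_pf x /\
     \sum_(i in I) x 0 i = (\sum_(n - #|I| + 1 <= i < n.+1) psum i)%N%:R].

(* Every B containing n+1 is T :|: {n+1} for T = emb @^-1: B. *)
Definition F_facet (B : {set 'I_n.+1}) : set 'rV[R]_n :=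
  if [pick i : 'I_n | B == [set emb i]%SET] is Some i then L_facet i
  else U_facet (~: (@emb n @^-1: B)).

Definition F_nested (N : {set {set 'I_n.+1}}) : set 'rV[R]_n :=
  X_pf `&` \bigcap_(B in [set` N]) F_facet B.

Lemma F_facet_single i : F_facet [set emb i]%SET = L_facet i.
Proof.
rewrite /F_facet; case: pickP => [j /eqP/finset.set1_inj/emb_inj -> //|].
by move=> /(_ i); rewrite eqxx.
Qed.

Lemma F_facet_star (T : {set 'I_n}) : F_facet (star_elt T) = U_facet (~: T).
Proof.
rewrite /F_facet; case: pickP => [j /eqP/setP/(_ ord_max)|_].
  by rewrite max_star finset.in_set1 eq_sym emb_neq_max.
by congr (U_facet (~: _)); apply/setP => i; rewrite finset.inE emb_star.
Qed.

End Polytope.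

Arguments X_pf R {n} b _.
Arguments F_nested R {n} b N _.

(* Main.v *)
(* X_n(b) is cut out by x_i >= 1 and by
   sum_(i in I) x_i <= S_(n-|I|+1) + ... + S_n, and its vertices are obtained
   from the permutations of (S_1, ..., S_n) by lowering some entries to 1.
   A linear functional c decomposes uniquely as a positive combination of the
   -e_i, for i in the set A where c is negative, and of the indicators of the
   upper level sets of c, which form a chain C of sets disjoint from A.  Hence
   the face of c is the intersection of the L_i, i in A, and the U_I, I in C,
   and all faces arise in this way.  If b_1 >= 2 the pairs (A, C) are exactly
   the nested sets.  If b_1 = 1, the one exception is U_I for I = [n] \ {a},
   which equals the intersection of L_a and U_[n]: this is how the nested sets
   {{a}, {n+1}} of B_PF arise.  Distinct nested sets have distinct faces because
   a facet that is not in N misses a vertex of F_N, obtained by breaking ties in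
   an ordering of [n] compatible with C. *)

Require Import Defs.
From mathcomp Require Import all_boot all_order all_algebra perm zify.

Set Implicit Arguments.
Unset Strict Implicit.
Unset Printing Implicit Defensive.

(** * Rankings of the ground set *)

Section RankedOrders.
Variable n : nat.
Implicit Types (k : 'I_n -> nat) (I : {set 'I_n}).

Lemma exists_ranking k :
  exists r : {perm 'I_n}, forall i j, k i < k j -> r i < r j.
Proof.
pose K i := k i * n + i.
have K_lt i j : k i < k j -> K i < K j.
  move=> kij; apply: (@leq_trans ((k i).+1 * n)).
    by rewrite mulSnr ltn_add2l.
  by apply: leq_trans (leq_addr _ _); rewrite leq_mul2r kij orbT.
have K_inj : injective K.
  move=> i j eqK; have eqk : k i = k j.
    by case: (ltngtP (k i) (k j)) => // /K_lt; rewrite eqK ltnn.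
  by move: eqK; rewrite /K eqk => /addnI /val_inj.
pose below i := [set j | K j < K i].
have below_lt i j : K i < K j -> #|below i| < #|below j|.
  move=> Kij; apply: proper_card; apply/properP; split.
    by apply/subsetP => l; rewrite !inE => /ltn_trans; apply.
  by exists i; rewrite !inE ?ltnn.
have lt_n i : #|below i| < n.
  rewrite -[X in _ < X](card_ord n) -cardsT; apply: proper_card.
  by apply/properP; split=> //; exists i; rewrite !inE ?ltnn.
pose r i := Ordinal (lt_n i).
have r_inj : injective r.
  move=> i j /(congr1 val) /= eq_below; apply: K_inj.
  by case: (ltngtP (K i) (K j)) => // /below_lt; rewrite eq_below ltnn.
by exists (perm r_inj) => i j kij; rewrite !permE; apply/below_lt/K_lt.
Qed.

Lemma card_ord_below l : l <= n -> #|[set m : 'I_n | m < l]| = l.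
Proof.
move=> le_n; rewrite -sum1_card -[RHS]card_ord -sum1_card.
by rewrite (big_ord_widen _ (fun=> 1) le_n); apply: eq_bigl => m; rewrite inE.
Qed.

Lemma card_ord_top l : l <= n -> #|[set m : 'I_n | n - l <= m]| = l.
Proof.
move=> le_n; have -> : [set m : 'I_n | n - l <= m] = ~: [set m : 'I_n | m < n - l].
  by apply/setP => m; rewrite !inE leqNgt.
by rewrite cardsCs setCK card_ord_below ?leq_subr // card_ord subKn.
Qed.

Lemma leq_card_ord I : #|I| <= n.
Proof. by rewrite -[X in _ <= X]card_ord max_card. Qed.

(** Every point outside [I] is ranked below each [i] in [I], so [r i] is at least [n - #|I|];
    cardinality then gives equality. *)
Lemma upset_image (r : {perm 'I_n}) I :
    (forall i j, i \in I -> j \notin I -> r j < r i) ->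
  [set r i | i in I] = [set m : 'I_n | n - #|I| <= m].
Proof.
move=> upI; apply/eqP; rewrite eqEcard card_ord_top ?leq_card_ord //.
rewrite card_imset ?leqnn ?andbT; last exact: perm_inj.
apply/subsetP => _ /imsetP[i iI ->]; rewrite inE.
have /subset_leq_card : [set r j | j in ~: I] \subset [set m : 'I_n | m < r i].
  by apply/subsetP => _ /imsetP[j jI ->]; rewrite !inE in jI *; rewrite upI.
rewrite card_imset; last exact: perm_inj.
rewrite card_ord_below => [le_r|]; last exact: ltnW.
rewrite leq_subLR -[X in X <= _](card_ord n) -(cardsC I) leq_add2l.
exact: le_r.
Qed.

End RankedOrders.

(** * Chains of subsets and the rankings that refine them *)

Section Chains.
Variable n : nat.
Implicit Types (C : {set {set 'I_n}}) (A I : {set 'I_n}) (r : {perm 'I_n}).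

Definition chain C :=
  forall I J, I \in C -> J \in C -> I \subset J \/ J \subset I.

(** A chain amounts to a weak ordering of the ground set: its nonempty members are superlevel sets
    of this function. *)
Definition depth C i := #|[set I in C | i \in I]|.

Definition refining C r := forall i j, depth C i < depth C j -> r i < r j.

Definition compatible A C :=
  chain C /\ (forall I, I \in C -> [disjoint A & I]).

Lemma depth_gt0 C I i : I \in C -> i \in I -> 0 < depth C i.
Proof. by move=> IC iI; apply/card_gt0P; exists I; rewrite inE IC. Qed.

Lemma depth_lt C I i j :
  chain C -> I \in C -> i \in I -> j \notin I -> depth C j < depth C i.
Proof.
move=> chC IC iI jI; apply/proper_card/properP; split.
  apply/subsetP => J; rewrite !inE => /andP[JC jJ]; rewrite JC.
  have [/subsetP sIJ|/subsetP sJI] := chC _ _ IC JC; first exact: sIJ.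
  by rewrite sJI in jI.
by exists I; rewrite !inE IC ?iI.
Qed.

(** The set is the smallest member [I0] containing [j]: points outside [I0] have smaller depth, and
    points of [I0] lie in every member that contains [j]. *)
Lemma depth_superlevel C j : chain C -> 0 < depth C j ->
  [set i | depth C j <= depth C i] \in C.
Proof.
move=> chC /card_gt0P[I1]; rewrite inE => I1Cj.
pose Cj := [pred I | (I \in C) && (j \in I)].
case: (@arg_minnP _ I1 Cj (fun I => #|I|) I1Cj) => I0 /andP[I0C jI0] minI0.
suff -> : [set i | depth C j <= depth C i] = I0 by [].
apply/setP => i; rewrite inE; apply/idP/idP => [|iI0].
  by apply: contraLR => iI0; rewrite -ltnNge (depth_lt chC I0C).
apply/subset_leq_card/subsetP => J; rewrite !inE => /andP[JC jJ]; rewrite JC.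
have [/subsetP sIJ|sJI] := chC _ _ I0C JC; first exact: sIJ.
suff -> : J = I0 by [].
by apply/eqP; rewrite eqEcard sJI minI0 /= ?JC.
Qed.

(** Doubling the depth leaves room for the bit [t], which decides ties without overriding the
    depth. *)
Lemma exists_refining_tie C (t : pred 'I_n) :
  exists2 r, refining C r &
    forall i j, depth C i <= depth C j -> ~~ t i -> t j -> r i < r j.
Proof.
have [r rP] := exists_ranking (fun i => (depth C i).*2 + t i).
exists r => i j ij; first by apply: rP; move: (t i) (t j) => [] []; lia.
by move=> ti tj; apply: rP; rewrite tj (negbTE ti); lia.
Qed.

Lemma compatibleU1 A C i :
  compatible A C -> depth C i = 0 -> compatible (i |: A) C.
Proof.
move=> [chC disj] i0; split=> // I IC.
rewrite -setI_eq0 setIUl setU_eq0 !setI_eq0 disj // andbT disjoints1.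
by apply: contra_eqN i0 => iI; rewrite -lt0n (depth_gt0 IC).
Qed.

(** Were all other points strictly deeper than [i], they would form a superlevel set, hence a member
    of size [n.-1]. *)
Lemma exists_depth_le C i : chain C -> 1 < n ->
    (forall I, I \in C -> #|I| != n.-1) ->
  exists2 j, j != i & depth C j <= depth C i.
Proof.
move=> chC n1 cardC.
have [j0 j0i] : exists j, j != i.
  have : 0 < #|~: [set i]| by rewrite cardsC1 card_ord; lia.
  by case/card_gt0P=> j; rewrite !inE; exists j.
case: (@arg_minnP _ j0 (predC1 i) (depth C) j0i) => j ji minj; exists j => //.
rewrite leqNgt; apply/negP => ij.
have /cardC/negP[] := depth_superlevel chC (leq_ltn_trans (leq0n _) ij).
rewrite (_ : [set _ | _] = ~: [set i]) ?cardsC1 ?card_ord //.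
apply/setP => l; rewrite !inE; apply/idP/idP; last exact: minj.
by apply: contraTN => /eqP ->; rewrite -ltnNge.
Qed.

End Chains.

(** * Partial sums and the vertices of the polytope *)

Section PartialSums.
Variables (n : nat) (b : 'I_n -> nat).
Hypothesis b_gt0 : forall i, 0 < b i.
Implicit Types (I J A : {set 'I_n}) (C : {set {set 'I_n}}) (r : {perm 'I_n}).

Definition top_sum k := \sum_(n - k + 1 <= i < n.+1) psum b i.

Lemma ltn_psum i j : i < j <= n -> psum b i < psum b j.
Proof.
case/andP=> ij jn; rewrite /psum [X in _ < X](bigID (fun l : 'I_n => l < i)) /=.
have -> : \sum_(l < n | (l < j) && (l < i)) b l = \sum_(l < n | l < i) b l.
  by apply: eq_bigl => l; rewrite andb_idl // => /ltn_trans; apply.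
rewrite -[X in X < _]addn0 ltn_add2l (bigD1 (Ordinal (leq_trans ij jn))) /=.
  by rewrite addn_gt0 b_gt0.
by rewrite ij ltnn.
Qed.

Lemma leq_psum i j : i <= j <= n -> psum b i <= psum b j.
Proof.
by case/andP; rewrite leq_eqVlt => /predU1P[->//|ij] jn; rewrite ltnW ?ltn_psum ?ij.
Qed.

Lemma psum_gt0 i : 0 < i <= n -> 0 < psum b i.
Proof. by move/ltn_psum; apply: leq_trans. Qed.

Lemma psum_gt1 i : 1 < i <= n -> 1 < psum b i.
Proof.
move=> /[dup] /andP[i1 i_n] /ltn_psum; apply: leq_trans.
by rewrite ltnS psum_gt0 //=; apply: leq_trans (ltnW i1) i_n.
Qed.

Lemma top_sumE I :
  top_sum #|I| = \sum_(m in [set m : 'I_n | n - #|I| <= m]) psum b m.+1.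
Proof.
rewrite /top_sum addn1 big_add1 (big_nat_widenl _ 0) //= big_mkord.
by apply: eq_bigl => m; rewrite inE.
Qed.

(** With [T] the top ranks, [J :\: T] and [T :\: J] have equal size, and [p] bounds the terms over
    the first from above and those over the second from below. *)
Lemma leq_top_sum J : \sum_(m in J) psum b m.+1 <= top_sum #|J|.
Proof.
rewrite top_sumE; set T := [set m | _].
rewrite (big_setID T) [X in _ <= X](big_setID J) /= setIC leq_add2l.
have cardTJ : #|J :\: T| = #|T :\: J|.
  apply/eqP; rewrite -(eqn_add2l #|J :&: T|) cardsID setIC cardsID.
  by rewrite card_ord_top ?leq_card_ord.
pose p := psum b (n - #|J|).
apply: (@leq_trans (\sum_(m in J :\: T) p)).
  apply: leq_sum => m; rewrite !inE -ltnNge => /andP[lt_m _].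
  by rewrite leq_psum // lt_m leq_subr.
rewrite sum_nat_const cardTJ -sum_nat_const; apply: leq_sum => m.
by rewrite !inE => /andP[_ le_m]; rewrite leq_psum // ltn_ord andbT ltnW.
Qed.

Lemma leq_perm_sum r I : \sum_(i in I) psum b (r i).+1 <= top_sum #|I|.
Proof.
have r_inj := @perm_inj _ r.
have := leq_top_sum (r @: I); rewrite big_imset ?card_imset //= => i j _ _.
exact: r_inj.
Qed.

(** Sorting assigns distinct ranks to the entries of [beta], and each entry is at most the partial
    sum at its rank. *)
Lemma parking_sum_le (beta : n.-tuple nat) I : parking_function b beta ->
  \sum_(i in I) tnth beta i <= top_sum #|I|.
Proof.
case=> _ sorted_le; have : perm_eq (sort leq beta) beta by rewrite perm_sort.
case/tuple_permP=> p sortE; apply: leq_trans (leq_perm_sum p^-1 I).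
apply: leq_sum => i _; have := sorted_le ((p^-1)%g i).
by rewrite sortE -tnth_nth tnth_mktuple permKV.
Qed.

(* These parking functions are the vertices of the polytope; ranks start at 0,
   so that S_(r(i)+1) is the entry of rank r i. *)
Definition vtx A r (i : 'I_n) := if i \in A then 1 else psum b (r i).+1.

Lemma vtx_le A r i : vtx A r i <= psum b (r i).+1.
Proof. by rewrite /vtx; case: ifP => // _; rewrite psum_gt0 /=. Qed.

Lemma vtx_parking A r : parking_function b [tuple vtx A r i | i < n].
Proof.
split=> i.
  by rewrite tnth_mktuple /vtx; case: ifP => // _; rewrite psum_gt0 /=.
set s := [tuple _ | _ < _].
(* It suffices that more than [i] entries are at most the bound; those of rank at most [i] are. *)
apply: (@Order.POrderTheory.nth_count_le _ nat _ 0 (sort leq s) i).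
  exact/sort_sorted/leq_total.
rewrite count_sort count_map; have lt_n : i.+1 <= n by exact: ltn_ord.
apply: (@leq_trans (count [pred j | r j < i.+1] (enum 'I_n))).
  rewrite -sum1_count big_enum_cond sum1_card; apply: eq_leq.
  rewrite -[LHS](card_ord_below lt_n) -(card_preimset _ (@perm_inj _ r)).
  by rewrite -sum1_card -[RHS]sum1_card; apply: eq_bigl => j; rewrite !inE.
apply: sub_count => j /= lt_j; apply: leq_trans (vtx_le A r j) _.
by rewrite leq_psum // lt_j lt_n.
Qed.

Lemma vtx_upset A r I : [disjoint A & I] ->
    (forall i j, i \in I -> j \notin I -> r j < r i) ->
  \sum_(i in I) vtx A r i = top_sum #|I|.
Proof.
move=> AI upI; rewrite top_sumE -(upset_image upI).
rewrite big_imset => [|i j _ _]; last exact: perm_inj.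
apply: eq_bigr => i iI; rewrite /vtx ifN //.
by apply: contraL iI => iA; rewrite (disjointFr AI).
Qed.

(** With [i] in place of [j] the set keeps its size and obeys [leq_perm_sum], while the partial sum
    at the rank of [i] exceeds the one at the rank of [j]. *)
Lemma vtx_swap_lt A r I i j :
    i \notin I -> i \notin A -> j \in I -> r j < r i ->
  \sum_(l in I) vtx A r l < top_sum #|I|.
Proof.
move=> iI iA jI rji.
have -> : #|I| = #|i |: I :\ j|.
  by rewrite cardsU1 !inE (negbTE iI) andbF (cardsD1 j I) jI.
apply: leq_trans (leq_perm_sum r _).
rewrite big_setU1 /=; last by rewrite !inE (negbTE iI) andbF.
rewrite (big_setD1 j jI) /= -addSn leq_add //; last first.
  by apply: leq_sum => l _; apply: vtx_le.
by apply: leq_ltn_trans (vtx_le A r j) _; rewrite ltn_psum // !ltnS rji /=.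
Qed.

Lemma vtx_low_lt A r I j : j \in I -> j \in A -> 1 < psum b (r j).+1 ->
  \sum_(l in I) vtx A r l < top_sum #|I|.
Proof.
move=> jI jA gt1; apply: leq_trans (leq_perm_sum r _).
rewrite !(big_setD1 j jI) /= -addSn leq_add //; first by rewrite /vtx jA.
by apply: leq_sum => l _; apply: vtx_le.
Qed.


(** * Vertices of a face that avoid a further facet *)

Definition attains A C (v : 'I_n -> nat) :=
  (forall i, i \in A -> v i = 1) /\
  (forall I, I \in C -> \sum_(i in I) v i = top_sum #|I|).

Lemma vtx_attains A A' C r :
    A \subset A' -> compatible A' C -> refining C r -> attains A C (vtx A' r).
Proof.
move=> /subsetP sAA' [chC disj] refC; split=> [i /sAA'|I IC].
  by rewrite /vtx => ->.
by apply: vtx_upset => [|i j iI jI]; [exact: disj | exact/refC/(depth_lt chC IC)].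
Qed.

(** For compatible [A] and [C] with [i] outside [A], this yields a vertex of the face off L_i. *)
Definition raisable C i :=
  exists2 r, refining C r & 1 < psum b (r i).+1.

(** Ties are broken in favour of [i], so its rank is at least 1, and S_2 > 1 even when S_1 = 1. *)
Lemma raisable_depth_le C i j : j != i -> depth C j <= depth C i -> raisable C i.
Proof.
move=> ji le_ji; have [r refC tie] := exists_refining_tie C (pred1 i).
exists r => //; rewrite psum_gt1 // ltnS ltn_ord andbT.
by apply: leq_trans (tie j i _ _ _) => //=; rewrite eqxx.
Qed.

Lemma raisable_gt1 C i : 1 < psum b 1 -> raisable C i.
Proof.
move=> gt1; have [r refC _] := exists_refining_tie C pred0.
by exists r => //; apply: leq_trans gt1 (leq_psum _); rewrite ltn_ord.
Qed.

Lemma separate_single A C i : compatible A C -> raisable C i -> i \notin A ->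
  exists A' r, attains A C (vtx A' r) /\ 1 < vtx A' r i.
Proof.
move=> AC [r refC gt1] iA; exists A, r; split; first exact: vtx_attains.
by rewrite /vtx (negbTE iA).
Qed.

Lemma separate_swap A C I i j : compatible A C ->
    i \notin I -> i \notin A -> j \in I -> depth C j <= depth C i ->
  exists A' r, attains A C (vtx A' r) /\
    \sum_(l in I) vtx A' r l < top_sum #|I|.
Proof.
move=> AC iI iA jI le_ji.
have [r refC tie] := exists_refining_tie C (fun l => l \notin I).
exists A, r; split; first exact: vtx_attains.
by apply: (vtx_swap_lt iI iA jI); apply: tie; rewrite ?jI.
Qed.

(** Let [j] be a point of [I] of least depth. At depth 0 it lies in no member of [C] and may be
    lowered to 1. Otherwise its superlevel set is a member of [C] properly containing [I], and ties
    are broken so that a point of it outside [I] outranks [j]. *)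
Lemma separate_set A C I : compatible A C -> I \notin C -> I != set0 ->
    (forall j, j \in I -> depth C j = 0 -> raisable C j) ->
  exists A' r, attains A C (vtx A' r) /\
    \sum_(l in I) vtx A' r l < top_sum #|I|.
Proof.
move=> AC IC /set0Pn[j0 j0I] raise; have [chC disj] := AC.
case: (@arg_minnP _ j0 (mem I) (depth C) j0I) => j jI minj.
have [j_0|j_gt0] := posnP (depth C j).
  have [r refC gt1] := raise j jI j_0; exists (j |: A), r; split.
    by apply: vtx_attains (subsetUr _ _) _ refC; exact: compatibleU1.
  by apply: vtx_low_lt gt1 => //; exact: setU11.
have I0C := depth_superlevel chC j_gt0; set I0 := [set i | _] in I0C.
have [i iI0 iI] : exists2 i, i \in I0 & i \notin I.
  apply/subsetPn; apply: contraNN IC => sI0I; suff -> : I = I0 by [].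
  apply/eqP; rewrite eqEsubset sI0I andbT; apply/subsetP => l lI.
  by rewrite inE minj.
apply: (separate_swap AC iI _ jI); last by rewrite inE in iI0.
by apply: contraL iI0 => iA; rewrite (disjointFr (disj _ I0C)).
Qed.

End PartialSums.

(** * Nested sets as pairs of a subset and a chain *)

Section NestedPairs.
Variable n : nat.
Implicit Types (A I T : {set 'I_n}) (C : {set {set 'I_n}}).
Implicit Types (N : {set {set 'I_n.+1}}) (P : pred {set 'I_n}).

Definition singles N : {set 'I_n} := [set i | [set emb i] \in N].

(* Stars are recorded by the complement I of T: F_B = U_I for B = T u {n+1}. *)
Definition costars N : {set {set 'I_n}} := [set I | star_elt (~: I) \in N].

Definition nested_of A C : {set {set 'I_n.+1}} :=
  [set [set emb i] | i in A] :|: [set star_elt (~: I) | I in C].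

Lemma star_elt_inj : injective (@star_elt n).
Proof.
move=> T T' eqT; apply/setP => i.
by rewrite -(emb_star T) -(emb_star T') eqT.
Qed.

Lemma single_neq_star i T : [set emb i] == star_elt T = false.
Proof.
by apply/eqP => /setP/(_ ord_max); rewrite max_star inE eq_sym emb_neq_max.
Qed.

Lemma single_in_nested_of i A C : ([set emb i] \in nested_of A C) = (i \in A).
Proof.
have single_inj : injective (fun j : 'I_n => [set emb j]).
  by move=> j l /set1_inj/emb_inj.
rewrite inE (mem_imset _ _ single_inj).
by rewrite orb_idr // => /imsetP[I _ /eqP]; rewrite single_neq_star.
Qed.

Lemma star_in_nested_of I A C :
  (star_elt (~: I) \in nested_of A C) = (I \in C).
Proof.
have costar_inj : injective (fun J : {set 'I_n} => star_elt (~: J)).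
  by move=> J K /star_elt_inj/setC_inj.
rewrite inE orbC (mem_imset _ _ costar_inj).
by rewrite orb_idr // => /imsetP[i _ /eqP]; rewrite eq_sym single_neq_star.
Qed.

Lemma in_nested_of B A C : B \in nested_of A C ->
  (exists2 i, i \in A & B = [set emb i]) \/
  (exists2 I, I \in C & B = star_elt (~: I)).
Proof. by case/setUP => /imsetP[x xP ->]; [left | right]; exists x. Qed.

(* The last clause is (N2) for the star of ~: I and the singletons of S. *)
Definition admissible P A C :=
  [/\ chain C,
      forall I, I \in C -> P (~: I) && (I != set0)
    & forall I S, I \in C -> S != set0 -> S \subset A :&: I -> ~~ P (~: I :|: S)].

Lemma nonmaximal_single_or_costar P B : P setT ->
    B \in singles_or_stars P :\: maximal_members (singles_or_stars P) ->
  (exists i, B = [set emb i]) \/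
  (exists2 I, P (~: I) && (I != set0) & B = star_elt (~: I)).
Proof.
move=> PT; rewrite maximal_singles_or_stars // => /setDP[+ BT].
case/in_singles_or_stars=> [|[T PTT defB]]; [by left|right].
exists (~: T); rewrite ?setCK // PTT; apply: contraNneq BT => T0.
by rewrite defB -(setCK T) T0 setC0 star_setT inE.
Qed.

Lemma nested_ofE P N : P setT -> nested_set (singles_or_stars P) N ->
  nested_of (singles N) (costars N) = N.
Proof.
move=> PT /and3P[/subsetP sub _ _]; apply/setP => B; apply/idP/idP.
  by case/in_nested_of => -[x]; rewrite inE => + ->.
move=> BN; have [[i defB]|[I _ defB]] := nonmaximal_single_or_costar PT (sub B BN).
  by rewrite defB single_in_nested_of inE -defB.
by rewrite defB star_in_nested_of inE -defB.
Qed.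

Lemma star_eltS T T' : star_elt T \subset star_elt T' -> T \subset T'.
Proof.
move=> /subsetP sTT'; apply/subsetP => i.
by rewrite -(emb_star T) -(emb_star T'); apply: sTT'.
Qed.

Lemma cover_star_singles T A :
  cover (star_elt T |: [set [set emb i] | i in A]) = star_elt (T :|: A).
Proof.
apply/setP => x; apply/bigcupP/idP => [[B]|].
  case/setU1P => [-> /setU1P[->|/imsetP[i iT ->]]|/imsetP[i iA ->] /set1P ->].
  - exact: max_star.
  - by rewrite emb_star inE iT.
  - by rewrite emb_star inE iA orbT.
case/setU1P => [->|/imsetP[i]].
  by exists (star_elt T); rewrite ?max_star ?setU11.
rewrite inE => /orP[iT ->|iA ->].
  by exists (star_elt T); rewrite ?emb_star ?setU11.
by exists [set emb i]; rewrite ?inE ?imset_f ?orbT.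
Qed.

Lemma nested_admissible P N : P setT -> nested_set (singles_or_stars P) N ->
  admissible P (singles N) (costars N).
Proof.
move=> PT /and3P[/subsetP sub /'forall_in_'forall_in_or3P laminar /forallP dis].
split.
- move=> I J; rewrite !inE => IN JN.
  case: (laminar _ IN _ JN) => [/star_eltS|/star_eltS|].
  + by rewrite setCS; right.
  + by rewrite setCS; left.
  + by move/disjoint_setI0/setP/(_ ord_max); rewrite in_setI !max_star inE.
- move=> I; rewrite inE => IN.
  have [[i /eqP]|[J JP /star_elt_inj/setC_inj ->//]] :=
    nonmaximal_single_or_costar PT (sub _ IN).
  by rewrite eq_sym single_neq_star.
- move=> I S; rewrite inE => IN S0 /subsetIP[/subsetP sSA /subsetP sSI].
  have := dis (star_elt (~: I) |: [set [set emb i] | i in S]).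
  rewrite cover_star_singles; apply: contraL => /star_in PIS.
  rewrite PIS implybF negbK; apply/and3P; split.
  + apply/subsetP => B /setU1P[->//|/imsetP[i /sSA]]; rewrite inE.
    by move=> iN ->.
  + rewrite cardsU1 card_imset; last by move=> j l /set1_inj/emb_inj.
    rewrite (_ : _ \notin _) ?ltnS ?card_gt0 //.
    by apply/imsetP => -[i _ /eqP]; rewrite eq_sym single_neq_star.
  + apply/trivIsetP => B B' /setU1P[->|/imsetP[i iS ->]]
      /setU1P[->|/imsetP[j jS ->]]; rewrite ?eqxx // => neqB.
    * by rewrite disjoint_sym disjoints1 emb_star inE sSI.
    * by rewrite disjoints1 emb_star inE sSI.
    * by rewrite disjoints1 inE; apply: contraNN neqB => /eqP ->.
Qed.

Lemma admissible_nested P A C : P setT ->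
  admissible P A C -> nested_set (singles_or_stars P) (nested_of A C).
Proof.
move=> PT [chC PC dis]; apply/and3P; split.
- apply/subsetP => B /in_nested_of[[i iA ->]|[I IC ->]];
    rewrite maximal_singles_or_stars // !in_setD in_set1.
    rewrite single_in andbT -star_setT single_neq_star //.
  have /andP[PI I0] := PC I IC.
  rewrite star_in // andbT -star_setT (inj_eq star_elt_inj) -setC0.
  by rewrite (inj_eq (@setC_inj _)).
- apply/forall_inP => B /in_nested_of[[i iA ->]|[I IC ->]];
    apply/forall_inP => B' /in_nested_of[[j jA ->]|[J JC ->]].
  + rewrite disjoints1 inE; case: eqP => [->|]; rewrite ?orbT //.
    by rewrite subxx.
  + by rewrite disjoints1 sub1set; case: (_ \in _); rewrite ?orbT.
  + by rewrite disjoint_sym disjoints1 sub1set; case: (_ \in _); rewrite ?orbT.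
  + have star_sub (K L : {set 'I_n}) :
        K \subset L -> star_elt (~: L) \subset star_elt (~: K).
      by rewrite -setCS => sKL; apply/setUS/imsetS.
    by case: (chC _ _ IC JC) => /star_sub ->; rewrite ?orbT.
apply/forallP => M; apply/implyP => /and3P[/subsetP sMN cardM trivM].
apply/negP => /in_singles_or_stars[[i covM]|[T PTT covM]].
  have M1 B : B \in M -> B = [set emb i].
    move=> BM; have : B \subset [set emb i] by rewrite -covM; apply: bigcup_sup.
    rewrite subset1 => /orP[/eqP//|/eqP B0].
    have := sMN B BM; rewrite B0 => /in_nested_of[[j _ /setP/(_ (emb j))]|].
      by rewrite !inE eqxx.
    by case=> I _ /setP/(_ ord_max); rewrite max_star inE.
  have : M \subset [set [set emb i]] by apply/subsetP => B /M1 ->; rewrite inE.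
  by move/subset_leq_card; rewrite cards1 leqNgt cardM.
(* The union is now a star, so some [B] in [M] contains [ord_max]. By disjointness the rest of [M]
   consists of singletons, collected in [S], which the third clause of [admissible] rules out. *)
have : ord_max \in cover M by rewrite covM max_star.
case/bigcupP => B BM maxB.
case/in_nested_of: (sMN B BM) => [[i _ defB]|[I IC defB]].
  by rewrite defB inE eq_sym emb_neq_max in maxB.
pose S := [set i | [set emb i] \in M].
have others B' : B' \in M -> B' != B -> exists2 i, i \in A & B' = [set emb i].
  move=> B'M neqB; case/in_nested_of: (sMN B' B'M) => // -[J _ defB'].
  have /trivIsetP/(_ B' B B'M BM neqB)/disjoint_setI0/setP/(_ ord_max) := trivM.
  by rewrite inE maxB defB' max_star inE.
have defM : M = star_elt (~: I) |: [set [set emb i] | i in S].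
  apply/setP => B'; apply/idP/setU1P => [B'M|[->|/imsetP[i]]].
  - rewrite -defB; have [->|neqB] := eqVneq B' B; [by left|right].
    have [i iA defB'] := others B' B'M neqB.
    by rewrite defB' imset_f // inE -defB'.
  - by rewrite -defB.
  - by rewrite inE => ? ->.
have S0 : S != set0.
  by apply: contraTneq cardM => S0; rewrite defM S0 imset0 setU0 cards1.
suff sSAI : S \subset A :&: I.
  have /negP[] := dis I S IC S0 sSAI.
  by move: covM; rewrite defM cover_star_singles => /star_elt_inj ->.
apply/subsetP => i; rewrite inE => iM; rewrite inE.
have neqB : [set emb i] != B by rewrite defB single_neq_star.
have [j jA /set1_inj/emb_inj eq_ij] := others _ iM neqB; rewrite eq_ij jA -eq_ij.
have /trivIsetP/(_ _ B iM BM neqB) := trivM.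
by rewrite disjoints1 defB emb_star inE negbK.
Qed.

End NestedPairs.

From mathcomp Require Import all_classical all_reals interval_inference convex.
From mathcomp Require Import ring lra.
Import Order.TTheory GRing.Theory Num.Theory.

(** * Faces of the polytope as sets of tight inequalities *)

Section TightFaces.
Variables (R : realType) (n : nat) (b : 'I_n -> nat).
Hypothesis b_gt0 : forall i, (0 < b i)%N.
Implicit Types (A I : {set 'I_n}) (C : {set {set 'I_n}}) (x : 'rV[R]_n).
Local Open Scope classical_set_scope.
Local Open Scope ring_scope.

(** Arbitrary pairs are allowed, so that U_([n] \ a) can occur in [C] also when b_1 = 1. *)
Definition tight_face A C : set 'rV[R]_n := [set x |
  [/\ X_pf R b x, forall i, i \in A -> x 0 i = 1
    & forall I, I \in C -> \sum_(i in I) x 0 i = (top_sum b #|I|)%:R]].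

Lemma X_pf_parking (v : 'I_n -> nat) :
  parking_function b [tuple v i | i < n] -> X_pf R b (\row_i (v i)%:R).
Proof.
move=> pv; apply: sub_gen_smallest; exists [tuple v i | i < n] => //.
by apply/rowP => i; rewrite !mxE tnth_mktuple.
Qed.

Lemma X_pf_le (c : 'I_n -> R) d :
    (forall beta, parking_function b beta ->
       \sum_i c i * (tnth beta i)%:R <= d) ->
  forall x, X_pf R b x -> \sum_i c i * x 0 i <= d.
Proof.
move=> le_d; apply: smallest_sub => [|_ [beta pb <-]]; last first.
  rewrite /= (eq_bigr (fun i => c i * (tnth beta i)%:R)) ?le_d // => i _.
  by rewrite mxE.
move=> x y l; rewrite !in_setE /= => le_x le_y.
rewrite (_ : \sum_i _ = l%:num * (\sum_i c i * x 0 i) +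
    (1 - l%:num) * (\sum_i c i * y 0 i)).
  have -> : d = l%:num * d + (1 - l%:num) * d by ring.
  by rewrite lerD // ler_wpM2l // subr_ge0.
rewrite !mulr_sumr -big_split /=; apply: eq_bigr => i _.
by rewrite /conv /= !mxE /unstable.onem; ring.
Qed.

Lemma X_pf_ge1 x i : X_pf R b x -> 1 <= x 0 i.
Proof.
have pick (y : 'I_n -> R) : \sum_j - (j == i)%:R * y j = - y i.
  rewrite (bigD1 i) //= eqxx mulN1r big1 ?addr0 // => j /negbTE ->.
  by rewrite oppr0 mul0r.
rewrite -lerN2 -(pick (x 0)); apply: X_pf_le => beta [gt0 _].
by rewrite (pick (fun j => (tnth beta j)%:R)) lerN2 ler1n.
Qed.

Lemma X_pf_sum_le x I :
  X_pf R b x -> \sum_(i in I) x 0 i <= (top_sum b #|I|)%:R.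
Proof.
have restrict (y : 'I_n -> R) : \sum_j (j \in I)%:R * y j = \sum_(j in I) y j.
  by rewrite [RHS]big_mkcond; apply: eq_bigr => j _; rewrite mulr_natl mulrb.
rewrite -restrict; apply: X_pf_le => beta pb.
by rewrite restrict -natr_sum ler_nat parking_sum_le.
Qed.

Lemma vtx_tight A C A' (r : {perm 'I_n}) :
  attains b A C (vtx b A' r) -> tight_face A C (\row_i (vtx b A' r i)%:R).
Proof.
case=> attA attC; split=> [|i iA|I IC].
- by apply: X_pf_parking; exact: vtx_parking.
- by rewrite mxE attA.
- by rewrite -attC // natr_sum; apply: eq_bigr => i _; rewrite mxE.
Qed.

Lemma tight_nonempty A C : compatible A C -> tight_face A C !=set0.
Proof.
move=> AC; have [r refC _] := exists_refining_tie C pred0.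
by exists (\row_i (vtx b A r i)%:R); apply: vtx_tight; exact: vtx_attains.
Qed.

(** The combination of the outward normals, with weight [lambda I] on the indicator of [I] and
    [alpha i] on -e_i; [height] combines the right-hand sides in the same way. *)
Definition slope (alpha : 'I_n -> R) (lambda : {set 'I_n} -> R) i :=
  \sum_(I : {set 'I_n} | i \in I) lambda I - alpha i.

Definition height (alpha : 'I_n -> R) (lambda : {set 'I_n} -> R) :=
  \sum_I lambda I * (top_sum b #|I|)%:R - \sum_i alpha i.

Lemma weighted_gap (alpha : 'I_n -> R) (lambda : {set 'I_n} -> R) x :
  height alpha lambda - \sum_i slope alpha lambda i * x 0 i =
  \sum_i alpha i * (x 0 i - 1)
    + \sum_I lambda I * ((top_sum b #|I|)%:R - \sum_(i in I) x 0 i).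
Proof.
rewrite /height; have -> : \sum_i slope alpha lambda i * x 0 i =
    \sum_I lambda I * (\sum_(i in I) x 0 i) - \sum_i alpha i * x 0 i.
  under eq_bigr do rewrite mulrBl mulr_suml.
  rewrite sumrB; congr (_ - _).
  rewrite (exchange_big_dep xpredT) //=; apply: eq_bigr => I _.
  by rewrite mulr_sumr.
under [X in _ = X + _]eq_bigr do rewrite mulrBr mulr1.
under [X in _ = _ + X]eq_bigr do rewrite mulrBr.
rewrite !sumrB; ring.
Qed.

(** The terms of [weighted_gap] are nonnegative on the polytope, so the gap vanishes exactly where
    each inequality of nonzero weight is tight. *)
Lemma weighted_face (alpha : 'I_n -> R) (lambda : {set 'I_n} -> R) :
    (forall i, 0 <= alpha i) -> (forall I, 0 <= lambda I) ->
  (forall x, X_pf R b x ->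
     \sum_i slope alpha lambda i * x 0 i <= height alpha lambda) /\
  tight_face [set i | alpha i != 0]%SET [set I | lambda I != 0]%SET =
    [set x | X_pf R b x /\
      \sum_i slope alpha lambda i * x 0 i = height alpha lambda].
Proof.
move=> alpha0 lambda0.
have low0 x i : X_pf R b x -> 0 <= alpha i * (x 0 i - 1).
  by move=> Xx; rewrite mulr_ge0 // subr_ge0 X_pf_ge1.
have high0 x I : X_pf R b x ->
    0 <= lambda I * ((top_sum b #|I|)%:R - \sum_(i in I) x 0 i).
  by move=> Xx; rewrite mulr_ge0 // subr_ge0 X_pf_sum_le.
split=> [x Xx|].
  by rewrite -subr_ge0 weighted_gap addr_ge0 ?sumr_ge0 // => ? _; auto.
apply/seteqP; split=> x /= [Xx].
  move=> alpha1 lambda1; split=> //; apply/esym/eqP.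
  rewrite -subr_eq0 weighted_gap !big1 ?addr0 // => [I|i] _.
    have [->|l0] := eqVneq (lambda I) 0; first by rewrite mul0r.
    by rewrite lambda1 ?subrr ?mulr0 // inE.
  have [->|a0] := eqVneq (alpha i) 0; first by rewrite mul0r.
  by rewrite alpha1 ?subrr ?mulr0 // inE.
move/esym/eqP; rewrite -subr_eq0 weighted_gap.
rewrite paddr_eq0 ?sumr_ge0 // => [/andP[]||]; try by move=> ? _; auto.
rewrite !psumr_eq0 => [/allP low /allP high||]; try by move=> ? _; auto.
split=> // [i|I]; rewrite inE => /negbTE nz.
  have := low i (mem_index_enum _); rewrite mulf_eq0 nz subr_eq0 => /eqP.
  exact.
have := high I (mem_index_enum _); rewrite mulf_eq0 nz subr_eq0 => /eqP.
exact: esym.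
Qed.

Lemma tight_is_face A C : is_face (X_pf R b) (tight_face A C).
Proof.
pose alpha i : R := (i \in A)%:R; pose lambda I : R := (I \in C)%:R.
have [le_d eqF] := @weighted_face alpha lambda (fun=> ler0n _ _) (fun=> ler0n _ _).
have nz (D : finType) (S : {set D}) : [set y | ((y \in S)%:R : R) != 0]%SET = S.
  by apply/setP => y; rewrite inE pnatr_eq0; case: (y \in S).
exists (\row_i slope alpha lambda i), (height alpha lambda).
have rowE x : \sum_i (\row_i slope alpha lambda i) 0 i * x 0 i =
    \sum_i slope alpha lambda i * x 0 i.
  by apply: eq_bigr => i _; rewrite mxE.
split=> [x /le_d|]; first by rewrite rowE.
rewrite /alpha /lambda !nz in eqF.
by rewrite eqF; apply/seteqP; split=> x /=; rewrite rowE.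
Qed.

(** Peeling: the support [S] receives the least value of [c] on it as its weight, and what remains
    of [c] has smaller support. *)
Lemma level_decomposition (c : 'I_n -> R) : (forall i, 0 <= c i) ->
  exists lambda : {set 'I_n} -> R,
  [/\ forall I, 0 <= lambda I,
      forall i, \sum_(I : {set 'I_n} | i \in I) lambda I = c i,
      chain [set I | lambda I != 0]%SET
    & forall I, lambda I != 0 ->
        I != finset.set0 /\ (forall i, i \in I -> c i != 0)].
Proof.
have [m] := ubnP #|[set i | c i != 0]%SET|.
elim: m c => // m IHm c /ltnSE supp_le c0.
set S := [set i | c i != 0]%SET in supp_le *.
have [S0|[i0 i0S]] := set_0Vmem S.
  exists (fun=> 0); split=> //.
  - by move=> i; rewrite big1 //; move/setP/(_ i): S0; rewrite !inE => /negbFE/eqP.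
  - by move=> I J; rewrite inE eqxx.
  - by move=> I; rewrite eqxx.
have [i1 i1S min_i1] : exists2 i1, i1 \in S & forall i, i \in S -> c i1 <= c i.
  by case: (@arg_minP _ _ _ i0 (mem S) c i0S) => i1 i1S min_i1; exists i1.
pose c' i := if i \in S then c i - c i1 else 0.
have [| |lambda [lambda0 sum_lambda chl suppl]] := IHm c'.
- apply: leq_trans supp_le; apply/proper_card/properP; split.
    apply/fintype.subsetP => i; rewrite !inE /c' inE.
    by case: ifP => //; rewrite eqxx.
  by exists i1; rewrite // inE /c' i1S subrr eqxx.
- by move=> i; rewrite /c'; case: ifP => // iS; rewrite subr_ge0 min_i1.
(* The sets used for the remainder miss the minimizer [i1], so the weight at [S] is still free. *)
have sub_S I : lambda I != 0 -> I \proper S.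
  move=> /suppl[_ nz]; apply/properP; split.
    by apply/fintype.subsetP => i /nz; rewrite /c'; case: ifP; rewrite // eqxx.
  by exists i1 => //; apply/negP => /nz; rewrite /c' i1S subrr eqxx.
have lambdaS : lambda S = 0.
  by apply/eqP; apply: contraT => /sub_S; rewrite fintype.properxx.
exists (fun I => if I == S then c i1 else lambda I).
have supp I : (if I == S then c i1 else lambda I) != 0 ->
    I = S \/ I \proper S /\ lambda I != 0.
  by case: (eqVneq I S) => [->|_ nz]; [left|right; split=> //; apply: sub_S].
split.
- by move=> I; case: ifP.
- move=> i; have [iS|iS] := boolP (i \in S); last first.
    rewrite big1 => [|I iI]; first by move: iS; rewrite inE negbK => /eqP.
    apply/eqP; apply: contraNT iS.
    case/supp=> [<- //|[/proper_sub/fintype.subsetP sIS _]].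
    exact: sIS.
  rewrite (bigD1 S) //= eqxx; have := sum_lambda i.
  rewrite (bigD1 S) //= lambdaS add0r /c' iS => eq_sum.
  rewrite (eq_bigr lambda) ?eq_sum; first by rewrite addrC subrK.
  by move=> I /andP[_ /negbTE ->].
- move=> I J; rewrite !inE.
  move=> /supp[->|[/proper_sub sIS nzI]] /supp[->|[/proper_sub sJS nzJ]]; auto.
  by apply: chl; rewrite inE.
- move=> I /supp[->|[/proper_sub/fintype.subsetP sIS /suppl[I0 _]]].
    split=> [|i]; last by rewrite inE.
    by apply/finset.set0Pn; exists i0.
  by split=> // i /sIS; rewrite inE.
Qed.

(** The negative and positive parts of [c] have disjoint supports, which makes [A] disjoint from
    every level set in [C]. *)
Lemma face_is_tight F : is_face (X_pf R b) F -> F !=set0 ->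
  exists A C, [/\ compatible A C, forall I, I \in C -> I != finset.set0
    & F = tight_face A C].
Proof.
case=> c [d [le_d ->]] [y [Xy eq_d]].
pose alpha i := Num.max 0 (- c 0 i); pose cp i := Num.max 0 (c 0 i).
have cE i : c 0 i = cp i - alpha i.
  by rewrite /cp /alpha; case: (lerP 0 (c 0 i)) => ?; case: lerP => ?; lra.
have [|lambda [lambda0 sum_lambda chl suppl]] := @level_decomposition cp.
  by move=> i; rewrite le_max lexx.
have alpha0 i : 0 <= alpha i by rewrite le_max lexx.
have [le_d' eqF] := weighted_face alpha0 lambda0.
set A := [set i | _]%SET in eqF; set C := [set I | _]%SET in eqF.
have AC : compatible A C.
  split=> // I; rewrite inE => /suppl[_ nz]; rewrite -finset.setI_eq0.
  apply/finset.set0Pn => -[i]; rewrite !inE => /andP[ai /nz].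
  move: ai; rewrite /alpha /cp.
  by case: (lerP 0 (c 0 i)) => ?; case: lerP => ? //; rewrite ?eqxx //; lra.
(* Both [d] and the height are upper bounds attained on the polytope, at [y] and at [z], so they
   coincide. *)
have [z] := tight_nonempty AC; rewrite eqF => -[Xz].
have rowE x : \sum_i slope alpha lambda i * x 0 i = \sum_i c 0 i * x 0 i.
  by apply: eq_bigr => i _; rewrite /slope sum_lambda -cE.
rewrite rowE => eq_z.
exists A, C; split=> [//|I|]; first by rewrite inE => /suppl[].
rewrite eqF; suff <- : d = height alpha lambda.
  by apply/seteqP; split=> x /=; rewrite rowE.
apply/eqP; rewrite eq_le; apply/andP; split; last by rewrite -eq_z le_d.
by rewrite -eq_d -rowE le_d'.
Qed.

End TightFaces.

(** * The face lattice in the cases b_1 >= 2 and b_1 = 1 *)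

Section FaceLattice.
Variables (R : realType) (n : nat) (b : 'I_n -> nat).
Hypothesis b_gt0 : forall i, (0 < b i)%N.
Implicit Types (A I : {set 'I_n}) (C : {set {set 'I_n}}) (P : pred {set 'I_n}).
Local Open Scope classical_set_scope.
Local Open Scope ring_scope.

Lemma F_nested_of A C : F_nested R b (nested_of A C) = tight_face b A C.
Proof.
apply/seteqP; split=> x.
  case=> Xx FN; split=> // [i iA|I IC].
    have : [set` nested_of A C] [set emb i]%SET by rewrite /= single_in_nested_of.
    by move/FN; rewrite F_facet_single => -[].
  have : [set` nested_of A C] (star_elt (~: I)) by rewrite /= star_in_nested_of.
  by move/FN; rewrite F_facet_star finset.setCK => -[].
case=> Xx tA tC; split=> // B /= /in_nested_of[[i iA ->]|[I IC ->]].
  by rewrite F_facet_single; split=> //; apply: tA.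
by rewrite F_facet_star finset.setCK; split=> //; apply: tC.
Qed.

(* [C'] may differ from [C] when b_1 = 1 only; the last two clauses say that
   every facet outside the nested set (A, C) misses a vertex of its face. *)
Definition resolves P A C C' :=
  [/\ compatible A C', tight_face (R := R) b A C' = tight_face b A C,
      forall i, i \notin A -> raisable b C' i
    & forall I, P (~: I)%SET -> I != finset.set0 -> I \notin C ->
        exists A' r, attains b A C' (vtx b A' r) /\
          (\sum_(i in I) vtx b A' r i < top_sum b #|I|)%N].

(** [resolves] gives nonempty faces and separating vertices, hence order reflection and with it
    injectivity; the last hypothesis and [face_is_tight] give surjectivity. *)
Lemma face_lattice_nested P : P [set: 'I_n]%SET ->
    (forall A C, admissible P A C -> exists C', resolves P A C C') ->
    (forall A C, compatible A C -> (forall I, I \in C -> I != finset.set0) ->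
       exists A' C', admissible P A' C' /\
         tight_face (R := R) b A' C' = tight_face b A C) ->
  set_bij [set` nested_complex (singles_or_stars P)]
          [set F | is_face (X_pf R b) F /\ F !=set0]
          (F_nested R b) /\
  (forall N1 N2, N1 \in nested_complex (singles_or_stars P) ->
     N2 \in nested_complex (singles_or_stars P) ->
     (N1 \subset N2 <-> F_nested R b N2 `<=` F_nested R b N1)).
Proof.
move=> PT resolve normalize.
have order N1 N2 : N1 \in nested_complex (singles_or_stars P) ->
    N2 \in nested_complex (singles_or_stars P) ->
    (N1 \subset N2 <-> F_nested R b N2 `<=` F_nested R b N1).
  rewrite !inE => nN1 nN2; split=> [/fintype.subsetP sN x [Xx FN]|sF].
    by split=> // B /= /sN BN; apply: FN.
  have adm1 := nested_admissible PT nN1.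
  have adm2 := nested_admissible PT nN2.
  rewrite -(nested_ofE PT nN1) -(nested_ofE PT nN2) !F_nested_of in sF.
  (* A facet of [N1] missing from [N2] would contain the face of [N2], but some vertex of that face
     lies off it. *)
  have [C' [AC' eqF raise sep]] := resolve _ _ adm2.
  apply/fintype.subsetP => B; rewrite -(nested_ofE PT nN1) => BN.
  rewrite -(nested_ofE PT nN2); apply: contraT.
  case/in_nested_of: BN => [[i iA ->]|[I IC ->]].
    rewrite single_in_nested_of => iA2.
    have [A' [r [att gt1]]] := separate_single AC' (raise i iA2) iA2.
    have /(vtx_tight R b_gt0) := att; rewrite eqF => /sF[_ /(_ i iA) + _].
    by rewrite mxE => /eqP; rewrite (eqr_nat R _ 1) => /eqP eq1; rewrite eq1 in gt1.
  rewrite star_in_nested_of => IC2; have [_ /(_ I IC)/andP[PI I0] _] := adm1.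
  have [A' [r [att lt_top]]] := sep I PI I0 IC2.
  have /(vtx_tight R b_gt0) := att; rewrite eqF => /sF[_ _ /(_ I IC)].
  under eq_bigr do rewrite mxE.
  by move/eqP; rewrite -natr_sum eqr_nat ltn_eqF.
split=> //; split.
- move=> N /=; rewrite inE => nN; have adm := nested_admissible PT nN.
  rewrite -(nested_ofE PT nN) F_nested_of; split; first exact: tight_is_face.
  have [C' [AC' <- _ _]] := resolve _ _ adm.
  exact: tight_nonempty.
- move=> N1 N2; rewrite !in_setE => N1c N2c eqF.
  apply/eqP; rewrite finset.eqEsubset.
  by apply/andP; split; apply/order => //; rewrite eqF.
- move=> F [faceF F0]; have [A [C [AC C0 ->]]] := face_is_tight b_gt0 faceF F0.
  have [A' [C' [adm <-]]] := normalize A C AC C0.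
  by exists (nested_of A' C'); rewrite ?F_nested_of //= inE admissible_nested.
Qed.

(** The last clause of [admissible] at [S = A :&: I] forces disjointness, and S_1 > 1 makes every
    point raisable. *)
Lemma resolves_St A C : (1 < psum b 1)%N ->
  admissible xpredT A C -> resolves xpredT A C C.
Proof.
move=> b1 [chC C0 dis].
have AC : compatible A C.
  split=> // I IC; rewrite -finset.setI_eq0; apply: contraT => AI0.
  by have := dis I _ IC AI0 (fintype.subxx _).
split=> // [i _|I _ I0 IC]; first exact: raisable_gt1.
by apply: separate_set => // j _ _; apply: raisable_gt1.
Qed.

Lemma compatible_St A C : compatible A C ->
  (forall I, I \in C -> I != finset.set0) -> admissible xpredT A C.
Proof.
move=> [chC disj] C0; split=> [//|I /C0 //|I S IC S0].
by rewrite (disjoint_setI0 (disj I IC)) finset.subset0 (negbTE S0).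
Qed.

Definition not_single I := #|I| != 1%N.

Lemma not_single_setCF I :
  not_single (~: I)%SET = false -> exists a, I = (~: [set a])%SET.
Proof.
by move/negbFE/cards1P => [a defI]; exists a; rewrite -defI finset.setCK.
Qed.

Hypotheses (n_gt1 : (1 < n)%N) (b1 : psum b 1 = 1%N).

Lemma top_sum_last : top_sum b n = (top_sum b n.-1).+1.
Proof.
have -> : top_sum b n.-1 = (\sum_(2 <= i < n.+1) psum b i)%N.
  by rewrite /top_sum (_ : n - n.-1 + 1 = 2)%N //; lia.
by rewrite /top_sum subnn add0n big_ltn ?b1 ?add1n //; lia.
Qed.

(* As S_1 = 1, the face U_([n]\a) is the intersection of L_a and U_[n]. *)
Lemma tight_face_swap A C a :
  tight_face (R := R) b (a |: A)%SET ([set: 'I_n] |: C)%SET =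
  tight_face b A (~: [set a] |: C)%SET.
Proof.
have cardT : #|[set: 'I_n]%SET| = n by rewrite cardsT card_ord.
have carda : #|(~: [set a])%SET| = n.-1 by rewrite cardsC1 card_ord.
have splitT (x : 'rV[R]_n) : \sum_(i in [set: 'I_n]%SET) x 0 i =
    x 0 a + \sum_(i in (~: [set a])%SET) x 0 i.
  rewrite (bigD1 a) ?inE //=; congr (_ + _).
  by apply: eq_bigl => i; rewrite !inE.
have topE : (top_sum b n)%:R = (top_sum b n.-1)%:R + 1 :> R.
  by rewrite top_sum_last natr1.
apply/seteqP; split=> x [Xx tA tC]; have := tC _ (setU11 _ _).
  rewrite splitT cardT topE tA ?setU11 // => tT; split=> // [i iA|I].
    by apply: tA; rewrite inE iA orbT.
  case/setU1P=> [->|IC]; last by apply: tC; rewrite inE IC orbT.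
  by rewrite carda; lra.
have xa_ge1 := X_pf_ge1 a Xx.
have := X_pf_sum_le b_gt0 [set: 'I_n]%SET Xx; rewrite splitT cardT topE.
rewrite carda => le_top ta; split=> // [i|I].
  by case/setU1P=> [->|]; [lra | exact: tA].
case/setU1P=> [->|IC]; last by apply: tC; rewrite inE IC orbT.
by rewrite splitT cardT topE; lra.
Qed.

(** Only when [n] is in [C] and [A] is nonempty must [C] change: then [A] is some {a}, and [n] \ a
    takes the place of [n]. *)
Lemma resolves_PF A C : admissible not_single A C ->
  exists C', resolves not_single A C C'.
Proof.
move=> [chC PC dis].
(* Adding a point [a] of [A :&: I] to the complement of [I] gives a singleton; as [a] is not in that
   complement, it is empty and [I] is [n]. *)
have dis1 I a : I \in C -> I != [set: 'I_n]%SET -> a \in A -> a \notin I.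
  move=> IC IT aA; apply/negP => aI.
  have /negbFE/cards1P[a' eqa'] : not_single (~: I :|: [set a])%SET = false.
    apply/negbTE/dis => //; first by apply/finset.set0Pn; exists a; rewrite inE.
    by rewrite finset.sub1set inE aA.
  have : a \in (~: I :|: [set a])%SET by rewrite !inE eqxx orbT.
  rewrite eqa' inE => /eqP defa; subst a'.
  case/negP: IT; rewrite -finset.subTset; apply/fintype.subsetP => i _.
  apply: contraLR aI => iI; have : i \in (~: I :|: [set a])%SET by rewrite !inE iI.
  by rewrite eqa' inE => /eqP <-.
have not_costar1 a : (~: [set a])%SET \notin C.
  by apply/negP => /PC; rewrite /not_single finset.setCK cards1.
have [/andP[TC /finset.set0Pn[a aA]]|generic] :=
    boolP (([set: 'I_n]%SET \in C) && (A != finset.set0)); last first.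
  have AC : compatible A C.
    split=> // I IC; rewrite -finset.setI_eq0; apply: contraR generic.
    case/finset.set0Pn=> a /setIP[aA aI].
    have [IT|IT] := eqVneq I [set: 'I_n]%SET.
      by rewrite -IT IC; apply/finset.set0Pn; exists a.
    by rewrite (negbTE (dis1 I a IC IT aA)) in aI.
  (* A member of size [n.-1] would have a single point as complement, so [exists_depth_le]
     applies. *)
  have raise i : raisable b C i.
    have [|j ji] := exists_depth_le i chC n_gt1; last exact: raisable_depth_le.
    move=> I IC; apply/negP => /eqP cardI; case/andP: (PC I IC) => /negP[].
    by rewrite cardsCs finset.setCK card_ord cardI; apply/eqP; lia.
  by exists C; split=> // I _ I0 IC; apply: separate_set.
have defA : A = [set a]%SET.
  have /negbFE/cards1P[a' defA] : not_single (~: [set: 'I_n] :|: A)%SET = false.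
    apply/negbTE/dis => //; first by apply/finset.set0Pn; exists a.
    by rewrite finset.setIT.
  move: defA; rewrite finset.setCT finset.set0U => defA.
  by move: aA; rewrite defA inE => /eqP ->.
pose C0 := (C :\ [set: 'I_n])%SET; pose Ca := (~: [set a] |: C0)%SET.
have C0a I : I \in C0 -> I \subset (~: [set a])%SET.
  case/setD1P=> IT IC; rewrite -finset.disjoints_subset disjoint_sym finset.disjoints1.
  exact: dis1.
have AC : compatible A Ca.
  split=> [I J /setU1P[->|IC] /setU1P[->|JC]|I].
  - by left.
  - by right; apply: C0a.
  - by left; apply: C0a.
  - by apply: chC; [case/setD1P: IC | case/setD1P: JC].
  rewrite defA finset.disjoints1; case/setU1P=> [->|/C0a/fintype.subsetP sI].
    by rewrite !inE eqxx.
  by apply/negP => /sI; rewrite !inE eqxx.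
(* For [Ca] the point [a] alone has depth 0, so every other point can outrank it. *)
have depth_a : depth Ca a = 0%N.
  apply/eqP; rewrite cards_eq0; apply/eqP/setP => I; rewrite finset.in_set0 [LHS]inE.
  by apply/negP => /andP[/AC.2 dis_AI]; rewrite (disjointFr dis_AI aA).
have gt0 j : j != a -> (0 < depth Ca j)%N.
  by move=> ja; apply: (depth_gt0 (setU11 _ _)); rewrite !inE.
exists Ca; split=> //.
- by rewrite /Ca -tight_face_swap finset.setD1K // defA finset.setUid.
- move=> i; rewrite defA inE => ia.
  by apply: (@raisable_depth_le _ _ _ _ _ a); rewrite ?depth_a // eq_sym.
- move=> I PI I0 IC.
  (* If [a] is in [I], some point outside [I] is ranked above it; otherwise all points of [I] have
     positive depth and none has to be raised. *)
  have [aI|aI] := boolP (a \in I).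
    have [i iI] : exists i, i \notin I.
      have : ~~ ([set: 'I_n]%SET \subset I).
        by rewrite finset.subTset; apply: contraNneq IC => ->.
      by case/subsetPn => i _; exists i.
    apply: (separate_swap b_gt0 AC iI _ aI); last by rewrite depth_a.
    by rewrite defA inE; apply: contraNneq iI => ->.
  apply: separate_set => // [|j jI j0].
    rewrite inE negb_or inE; apply/andP; split; last first.
      by rewrite !inE (negbTE IC) andbF.
    by apply: contraTneq PI => ->; rewrite /not_single finset.setCK cards1.
  have := gt0 j; rewrite j0; case: eqVneq => [ja|_ /(_ isT)//].
  by rewrite -ja jI in aI.
Qed.

(** If some [n] \ a is in [C], then [tight_face_swap] trades it for [n] and puts [a] into [A];
    otherwise the pair is already admissible. *)
Lemma compatible_PF A C : compatible A C ->
    (forall I, I \in C -> I != finset.set0) ->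
  exists A' C', admissible not_single A' C' /\
    tight_face (R := R) b A' C' = tight_face b A C.
Proof.
move=> [chC disj] C0.
have carda a : #|(~: [set a])%SET : {set 'I_n}| = n.-1 by rewrite cardsC1 card_ord.
have [/existsP[a aC]|/existsPn none] :=
    boolP [exists a, (~: [set a])%SET \in C]; last first.
  exists A, C; split=> //; split=> // [I IC|I S IC S0].
    rewrite C0 // andbT; apply: contraT => /negPf/not_single_setCF[a defI].
    by have := none a; rewrite -defI IC.
  by rewrite (disjoint_setI0 (disj I IC)) finset.subset0 (negbTE S0).
pose Ca := (C :\ ~: [set a])%SET.
have Aa : (a |: A = [set a])%SET.
  apply/setP => i; rewrite !inE orb_idr // => iA.
  by have := disjointFr (disj _ aC) iA; rewrite !inE => /negbFE.
have below I : I \in Ca -> I != [set: 'I_n]%SET -> I \proper (~: [set a])%SET.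
  case/setD1P=> Ia IC IT; rewrite finset.properEneq Ia.
  have [//|sI] := chC _ _ IC aC.
  have aI : a \in I.
    apply: contraNT Ia => aI; rewrite finset.eqEsubset sI andbT.
    by rewrite -finset.disjoints_subset disjoint_sym finset.disjoints1.
  case/eqP: IT; apply/setP => i; rewrite inE.
  have [->//|ia] := eqVneq i a.
  by apply: (fintype.subsetP sI); rewrite !inE.
exists [set a]%SET, ([set: 'I_n] |: Ca)%SET; split; last first.
  by rewrite -Aa tight_face_swap finset.setD1K.
split.
- move=> I J /setU1P[->|/setD1P[_ IC]] /setU1P[->|/setD1P[_ JC]];
    rewrite ?finset.subsetT; auto.
- move=> I /setU1P[->|ICa].
    rewrite /not_single finset.setCT cards0 /=.
    by apply/finset.set0Pn; exists a; rewrite inE.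
  have /setD1P[Ia IC] := ICa; rewrite C0 // andbT.
  apply: contraT => /negPf/not_single_setCF[a' defI].
  have IT : I != [set: 'I_n]%SET.
    by apply/eqP => IT; have := carda a'; rewrite -defI IT cardsT card_ord; lia.
  have /proper_card := below I ICa IT.
  by rewrite carda defI carda ltnn.
(* For [I] = [n] the only choice of [S] is {a}, whose star is not in [B_PF]; all other members miss
   [a], so [S] would be empty. *)
- move=> I S /setU1P[->|ICa] S0 sS.
    rewrite finset.setIT subset1 (negbTE S0) orbF in sS.
    by rewrite (eqP sS) finset.setCT finset.set0U /not_single cards1.
  have [IT|IT] := eqVneq I [set: 'I_n]%SET.
    rewrite IT finset.setIT subset1 (negbTE S0) orbF in sS.
    by rewrite IT (eqP sS) finset.setCT finset.set0U /not_single cards1.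
  have aI : a \notin I.
    by rewrite -disjoints1 disjoint_sym finset.disjoints_subset proper_sub ?below.
  move: sS; rewrite (disjoint_setI0 _) ?finset.subset0 ?(negbTE S0) //.
  by rewrite finset.disjoints1.
Qed.

End FaceLattice.

Local Open Scope classical_set_scope.

Theorem theorem3p12 (R : realType) (n : nat) (n_gt0 : (0 < n)%N)
    (b : 'I_n -> nat) (b_gt0 : forall i, (0 < b i)%N)
    (nb_neq1 : ~ (n = 1%N /\ b (Ordinal n_gt0) = 1%N)) :
  let B := if b (Ordinal n_gt0) == 1%N then B_PF n else B_St n in
  set_bij [set` nested_complex B]
          [set F | is_face (X_pf R b) F /\ F !=set0]
          (F_nested R b) /\
  (forall N1 N2, N1 \in nested_complex B -> N2 \in nested_complex B ->
     (N1 \subset N2 <-> F_nested R b N2 `<=` F_nested R b N1)).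
Proof.
have psum1 : psum b 1 = b (Ordinal n_gt0).
  rewrite /psum (big_pred1 (Ordinal n_gt0)) // => i.
  by rewrite ltnS leqn0.
have [b1|b1] := eqVneq (b (Ordinal n_gt0)) 1%N.
  (* Since b_1 = 1 here, the excluded case rules out n = 1. *)
  have n_gt1 : (1 < n)%N.
    by case: (ltngtP n 1) => // n1; [rewrite ltnNge n_gt0 in n1 | case: nb_neq1].
  rewrite b1 in psum1; apply: (@face_lattice_nested _ _ _ b_gt0 (@not_single n)).
  - by rewrite /not_single cardsT card_ord gtn_eqF.
  - exact: resolves_PF.
  - exact: compatible_PF.
have gt1 : (1 < psum b 1)%N by rewrite psum1 ltn_neqAle eq_sym b1 b_gt0.
rewrite B_StE; apply: face_lattice_nested => // A C.
  by move=> adm; exists C; apply: resolves_St.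
by move=> AC C0; exists A, C; split=> //; apply: compatible_St.
Qed.
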